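(* Let $(G,\tau)$ be a Hausdorff topological group. Then $(G,\tau)$ is an $s$-group if and only if every sequentially continuous homomorphism from $(G,\tau)$ to a Hausdorff topological group $(X,\sigma)$ is continuous.
   Context: A set $S$ of sequences in a group $G$ is a $T_s$-set of sequences if there is a Hausdorff group topology on $G$ in which all sequences of $S$ converge to the unit $e_G$; then $\tau_S$ denotes the finest Hausdorff group topology on $G$ with this property. A Hausdorff topological group $(G,\tau)$ is called an $s$-group if $\tau=\tau_S$ for some $T_s$-set $S$ of sequences in $G$. A mapping $f:X\to Y$ between topological spaces is sequentially continuous if $x_n\to x_0$ in $X$ implies $f(x_n)\to f(x_0)$ in $Y$. *)

(* Defs.v *)
From HB Require Import structures.
From mathcomp Require Import all_boot.
From mathcomp Require Import all_classical.
From mathcomp Require Import topology.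

Set Implicit Arguments.
Unset Strict Implicit.
Unset Printing Implicit Defensive.

Local Open Scope classical_set_scope.

(* Topologies are first-class values here, because several topologies on the
   same group have to be compared.  [space tau] is the carrier of [tau] seen as
   a topologicalType, which gives access to the library's notions of
   convergence, continuity and separation. *)
Record topology (T : Type) := Topology {
  opens : set (set T);
  opensT : opens setT;
  opensI : setI_closed opens;
  opens_bigcup : forall F : set (set T),
    F `<=` opens -> opens (\bigcup_(A in F) A) }.

Definition space (T : choiceType) (tau : topology T) : Type := T.

Section Space.
Context (T : choiceType) (tau : topology T).

HB.instance Definition _ := Choice.on (space tau).

Lemma space_bigU (I : Type) (f : I -> set (space tau)) :
  (forall i, opens tau (f i)) -> opens tau (\bigcup_i f i).
Proof.
move=> fo; rewrite -(bigcup_image setT f id).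
by apply: opens_bigcup => _ [i _ <-]; exact: fo.
Qed.

HB.instance Definition _ := isOpenTopological.Build (space tau)
  (opensT tau) (@opensI _ tau) space_bigU.

Lemma open_space : @open (space tau) = opens tau.
Proof. by []. Qed.

End Space.

HB.instance Definition _ (G : groupType) (tau : topology G) :=
  Group.copy (space tau) G.

Definition group_topology (G : groupType) (tau : topology G) : Prop :=
  continuous (fun p : space tau * space tau => (p.1 * p.2)%g) /\
  continuous (fun x : space tau => x^-1%g).

Definition hausdorff_group_topology (G : groupType) (tau : topology G) : Prop :=
  group_topology tau /\ hausdorff_space (space tau).

Definition finer (T : Type) (tau tau' : topology T) : Prop :=
  opens tau' `<=` opens tau.

Section SGroups.
Context (G : groupType).
Implicit Types (S : set (nat -> G)) (tau : topology G).

Definition all_converge_to_unit S tau : Prop :=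
  forall u : nat -> space tau, S u -> u n @[n --> \oo] --> (1%g : space tau).

Definition Ts_set S : Prop :=
  exists tau, hausdorff_group_topology tau /\ all_converge_to_unit S tau.

(* [is_tau S tau] reads "tau = tau_S". *)
Definition is_tau S tau : Prop :=
  [/\ hausdorff_group_topology tau,
      all_converge_to_unit S tau &
      forall tau', hausdorff_group_topology tau' ->
        all_converge_to_unit S tau' -> finer tau tau'].

Definition s_group tau : Prop :=
  hausdorff_group_topology tau /\ exists2 S, Ts_set S & is_tau S tau.

End SGroups.

Definition sequentially_continuous (X Y : topologicalType) (f : X -> Y) : Prop :=
  forall (u : nat -> X) (x : X),
    u n @[n --> \oo] --> x -> f (u n) @[n --> \oo] --> f x.

(* Main.v *)
(* If tau = tau_S and f is sequentially continuous, the join of tau and the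
   pullback of sigma along f is a Hausdorff group topology in which every
   sequence of S still converges to the unit; by maximality tau is finer than
   it, that is, f is continuous.  Conversely, take for S all the sequences
   converging to the unit in tau: for any competitor tau', the identity from tau
   to tau' is sequentially continuous by translation, hence continuous. *)
Require Import Defs.
From mathcomp Require Import all_boot.
From mathcomp Require Import all_classical.
From mathcomp Require Import topology.

Set Implicit Arguments.
Unset Strict Implicit.
Unset Printing Implicit Defensive.

Local Open Scope classical_set_scope.

Lemma finer_continuous_id (T : choiceType) (tau tau' : topology T) :
  finer tau tau' <-> continuous (id : space tau -> space tau').
Proof. by split=> [tt'|/continuousP tt' A /tt' //]; apply/continuousP => A /tt'. Qed.

Lemma finer_hausdorff (T : choiceType) (tau tau' : topology T) :
  finer tau tau' -> hausdorff_space (space tau') -> hausdorff_space (space tau).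
Proof.
move=> /finer_continuous_id tt' hT x y xy; apply: hT => A B nA nB.
by apply: xy; [exact: tt' nA | exact: tt' nB].
Qed.

Section GraphTopology.
Context (T U : choiceType) (tau : topology T) (sigma : topology U) (f : T -> U).

Let graph (x : T) : (space tau * space sigma)%type := (x, f x).

(* The join of [tau] and of the pullback of [sigma] along [f] is induced by the
   product topology through [x |-> (x, f x)]. *)
Definition graph_topology : topology T :=
  @Topology T (@open (initial_topology graph)) openT
    (@openI (initial_topology graph))
    (fun F oF => @bigcup_open (initial_topology graph) _ F id oF).

(** Convergence for an initial topology is convergence of the images in the product, which is tested
    on the two coordinates. *)
Lemma cvg_graph_topology (I : Type) (F : set_system I) (u : I -> T) (x : T) :
  Filter F ->
  u i @[i --> F] --> (x : space graph_topology) <->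
  u i @[i --> F] --> (x : space tau) /\
  f (u i) @[i --> F] --> (f x : space sigma).
Proof.
move=> FF; split=> [ux | [ux fux]].
  have cgraph : continuous (graph : space graph_topology -> _).
    by apply/continuousP => A oA; exists A.
  have gux : graph (u i) @[i --> F] --> graph x by move=> A /(cgraph x) /ux.
  by split; [exact: cvg_comp gux cvg_fst | exact: cvg_comp gux cvg_snd].
(* Some open [W] of the product has its preimage under [graph] inside [V]; the paired limits put
   [graph (u i)] eventually in [W]. *)
move=> V; rewrite nbhsE => -[_ [[W oW <-] Wx] /filterS]; apply.
have: nbhs (graph x) W by exact: open_nbhs_nbhs.
exact: (cvg_pair ux fux).
Qed.

Lemma graph_topology_cvg (x : space graph_topology) :
  y @[y --> x] --> (x : space tau) /\
  f y @[y --> x] --> (f x : space sigma).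
Proof. exact/(cvg_graph_topology id (x : T) (nbhs_filter x))/cvg_id. Qed.

Lemma finer_graph_topology : finer graph_topology tau.
Proof.
by apply/finer_continuous_id => x; have [] := graph_topology_cvg x.
Qed.

End GraphTopology.

Section GroupTopologyLimits.
Context (G : groupType) (tau : topology G) (gtau : group_topology tau).
Context (I : Type) (F : set_system I) {FF : Filter F}.
Implicit Types (u v : I -> space tau) (x y : space tau).

Lemma group_topology_cvgM u v x y :
  u i @[i --> F] --> x -> v i @[i --> F] --> y ->
  (u i * v i)%g @[i --> F] --> (x * y : space tau)%g.
Proof. by move=> ux vy; apply: continuous2_cvg ux vy; exact: (gtau.1 (x, y)). Qed.

Lemma group_topology_cvgV u x :
  u i @[i --> F] --> x -> (u i)^-1%g @[i --> F] --> (x^-1 : space tau)%g.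
Proof. by move=> ux; apply: continuous_cvg ux; exact: gtau.2. Qed.

End GroupTopologyLimits.

(* [gmulfV] requires a unital morphism, but [{multiplicative G -> X}] only
   records compatibility with the product. *)
Lemma multiplicative_invg (G X : groupType) (f : {multiplicative G -> X}) x :
  f x^-1%g = (f x)^-1%g.
Proof.
have f1 : f 1%g = 1%g by apply: (mulgI (f 1%g)); rewrite -gmulfM !mulg1.
by apply: (mulIg (f x)); rewrite -gmulfM !mulVg.
Qed.

(** Each limit splits into one for [tau] and one for [sigma] after applying [f]; since [f] respects
    the operations, the latter reduces to their continuity in [X]. *)
Lemma graph_group_topology (G X : groupType) (tau : topology G)
    (sigma : topology X) (f : {multiplicative G -> X}) :
  group_topology tau -> group_topology sigma ->
  group_topology (graph_topology tau sigma f).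
Proof.
move=> gtau gsigma.
have cvgD (x : space (graph_topology tau sigma f)) := graph_topology_cvg x.
split=> [[x y]|x].
  apply/cvg_graph_topology.
  have [[x1 x2] [y1 y2]] := (cvgD x, cvgD y); split.
    apply: (group_topology_cvgM gtau).
      exact: cvg_comp cvg_fst x1.
    exact: cvg_comp cvg_snd y1.
  rewrite gmulfM; under eq_cvg do rewrite gmulfM.
  apply: (group_topology_cvgM gsigma).
    exact: cvg_comp cvg_fst x2.
  exact: cvg_comp cvg_snd y2.
apply/cvg_graph_topology; first exact: (nbhs_filter x).
have [x1 x2] := cvgD x; split; first exact: (group_topology_cvgV gtau (FF := nbhs_filter x) x1).
rewrite multiplicative_invg; under eq_cvg do rewrite multiplicative_invg.
exact: (group_topology_cvgV gsigma (FF := nbhs_filter x) x2).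
Qed.

Theorem theorem1p11 (G : groupType) (tau : topology G)
  (htau : hausdorff_group_topology tau) :
  s_group tau <->
  forall (X : groupType) (sigma : topology X),
    hausdorff_group_topology sigma ->
    forall f : {multiplicative G -> X},
      sequentially_continuous (f : space tau -> space sigma) ->
      continuous (f : space tau -> space sigma).
Proof.
split=> [[_ [S _ [[gtau ttau] Stau tau_finest]]] X sigma [gsigma _] f fseq|fcont].
  (* Continuity of [f] is then the second coordinate of the limits given by [fin]. *)
  suff /finer_continuous_id fin : finer tau (graph_topology tau sigma f).
    by move=> x; have /cvg_graph_topology[] := fin x.
  apply: tau_finest.
    split; first exact: graph_group_topology.
    exact: (finer_hausdorff (@finer_graph_topology _ _ tau sigma f)) ttau.
  move=> u Su; apply/cvg_graph_topology; split; first exact: Stau.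
  exact/fseq/Stau.
pose S := [set u : nat -> G | u n @[n --> \oo] --> (1%g : space tau)].
have Stau : all_converge_to_unit S tau by [].
split=> //; exists S; first by exists tau.
split=> // tau' htau' Stau'; apply/finer_continuous_id.
(* The test group is [G] itself with the competitor [tau']. *)
apply: (fcont G tau' htau' idfun) => u x ux /=.
(* The translate by [x^-1] tends to the unit for [tau], so it belongs to [S]; multiplying back by
   the constant [x] recovers [u]. *)
have : (x^-1 * u n)%g @[n --> \oo] --> (1%g : space tau').
  apply: Stau'; rewrite /S /= -(mulVg x).
  by apply: (group_topology_cvgM htau.1) ux; exact: cvg_cst.
move=> /(group_topology_cvgM htau'.1 (cvg_cst (x : space tau'))).
by rewrite mulg1; under eq_cvg do rewrite mulVKg.
Qed.
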